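(* For $n\ge2$ the splitting measure $\nu_{n,-1}^{\ast}$ at $z=-1$ is a nonnegative measure on $S_n$ supported on the conjugacy classes $C_\lambda$ with $\lambda=[1^n]$, the identity class, and $\lambda=[2,1^{n-2}]$, the class of a $2$-cycle. It has equal mass $\nu_{n,-1}^{\ast}(C_\lambda)=\frac12$ on these two classes.
   Context: For a partition $\lambda\vdash n$, $m_j(\lambda)$ is the number of parts equal to $j$, and $C_\lambda\subset S_n$ is the conjugacy class of permutations of cycle type $\lambda$; $[2,1^{n-2}]$ is the partition with one part $2$ and $n-2$ parts $1$, and $[1^n]$ the partition with $n$ parts $1$. The $m$-th necklace polynomial is $M_m(X)=\frac1m\sum_{d\mid m}\mu(d)X^{m/d}$. For $z\in\mathbb{C}\setminus\{0,1\}$ the $z$-splitting measure on $S_n$ is defined on conjugacy classes by $$\nu_{n,z}^{\ast}(C_\lambda)=\frac{1}{z^{n-1}(z-1)}\prod_{j=1}^n\binom{M_j(z)}{m_j(\lambda)},\qquad \binom{t}{k}=\frac{t(t-1)\cdots(t-k+1)}{k!},$$ and on elements by $\nu_{n,z}^{\ast}(g)=\nu_{n,z}^{\ast}(C_\lambda)/|C_\lambda|$ for $g\in C_\lambda$. *)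

(* Defs.v *)
From HB Require Import structures.
From mathcomp Require Import all_boot all_order all_algebra all_fingroup.
From mathcomp Require Import reals complex.
Set Implicit Arguments.
Unset Strict Implicit.
Unset Printing Implicit Defensive.
Import Order.TTheory GRing.Theory Num.Theory.
Local Open Scope ring_scope.

Definition is_partition (n : nat) (la : seq nat) : bool :=
  [&& sorted geq la, all (leq 1) la & sumn la == n].

(* Fixed points are orbits of size 1, so they are recorded as parts 1. *)
Definition cycle_type (n : nat) (s : 'S_n) : seq nat :=
  sort geq [seq #|B| | B : {set 'I_n} in porbits s].

Definition cycle_class (n : nat) (la : seq nat) : {set 'S_n} :=
  [set s : 'S_n | cycle_type s == la].

(* Only used for d > 0; the value at 0 is irrelevant. *)
Definition mobius (d : nat) : int :=
  if all (fun p => logn p d == 1%N) (primes d)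
  then (-1) ^+ size (primes d) else 0.

Definition necklace (F : numFieldType) (m : nat) : {poly F} :=
  (m%:R)^-1 *: \sum_(d <- divisors m) (mobius d)%:~R *: 'X^(m %/ d).

Definition gbinom (F : numFieldType) (t : F) (k : nat) : F :=
  (\prod_(i < k) (t - (i : nat)%:R)) / (k`!)%:R.

(* Meaningful for z distinct from 0 and 1, where z ^+ n.-1 * (z - 1) is
   invertible. *)
Definition splitting_class (F : numFieldType) (n : nat) (z : F) (la : seq nat) :
    F :=
  (z ^+ n.-1 * (z - 1))^-1 *
  \prod_(1 <= j < n.+1) gbinom (necklace F j).[z] (count_mem j la).

Definition splitting_elt (F : numFieldType) (n : nat) (z : F) (g : 'S_n) : F :=
  splitting_class n z (cycle_type g) / #|cycle_class n (cycle_type g)|%:R.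

Definition splitting_measure (F : numFieldType) (n : nat) (z : F)
    (A : {set 'S_n}) : F :=
  \sum_(g in A) splitting_elt z g.

(* Main.v *)
Require Import Defs.
From HB Require Import structures.
From mathcomp Require Import all_boot all_order all_algebra all_fingroup.
From mathcomp Require Import reals complex.
From mathcomp Require Import zify ring.
Set Implicit Arguments.
Unset Strict Implicit.
Unset Printing Implicit Defensive.
Import Order.TTheory GRing.Theory Num.Theory.
Local Open Scope ring_scope.
Local Open Scope complex_scope.

(** At z = -1 the necklace polynomials take the values M_1 = -1, M_2 = 1 and
    M_m = 0 for m >= 3 ([necklace_at_N1]).  This follows from the vanishing of
    the divisor sums of the Moebius function: writing (-1)^k as twice the
    indicator of k being even, minus 1, turns m * M_m(-1) into twice the sum
    of mu(d) over the d dividing m / 2 (an empty sum for odd m), minus the sum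
    of mu(d) over the d dividing m, that is, 2 [m = 2] - [m = 1].

    Since binom(-1, k) = (-1)^k, binom(1, k) = [k <= 1] and
    binom(0, k) = [k = 0], the class of la has nonzero mass exactly when la has
    no part larger than 2 and at most one part 2, which leaves [1^n] and
    [2,1^(n-2)].  On both, the sign (-1)^(m_1(la)) = (-1)^n cancels the sign of
    the denominator z^(n-1) (z - 1) = 2 (-1)^n, so that the mass is 1/2.

    The two classes of permutations are recognised by their number of cycles.
    A partition of n with n parts is [1^n], and one with n - 1 parts is
    [2,1^(n-2)]; a permutation with n cycles is the identity, and one with
    n - 1 cycles is a transposition, because multiplying by a transposition
    that splits one of its cycles yields n cycles. *)

(** * Sums of the Moebius function *)

(** The prime divisors of p * e are those of e together with p, and p occurs
    only once, so that squarefreeness is unchanged and the sign flips. *)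
Lemma mobius_mul_prime (p e : nat) :
  prime p -> (0 < e)%N -> ~~ (p %| e)%N -> mobius (p * e) = - mobius e.
Proof.
move=> p_pr e_gt0 pNe; have p_gt0 := prime_gt0 p_pr.
have p_new : p \notin primes e by rewrite mem_primes p_pr e_gt0.
have primes_pe : perm_eq (primes (p * e)) (p :: primes e).
  apply: uniq_perm; rewrite /= ?primes_uniq ?p_new // => q.
  by rewrite primesM // inE primes_prime // inE.
rewrite /mobius (perm_all _ primes_pe) (perm_size primes_pe) /=.
have -> : logn p (p * e) = 1%N.
  by rewrite lognM // logn_prime // eqxx lognE (negPf pNe) !andbF.
have -> : all (fun q => logn q (p * e) == 1%N) (primes e) =
          all (fun q => logn q e == 1%N) (primes e).
  apply: eq_in_all => q q_e; rewrite lognM // logn_prime; last first.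
    by move: q_e; rewrite mem_primes => /andP[].
  by case: (q =P p) q_e p_new => // -> ->.
by rewrite eqxx /=; case: ifP; rewrite ?oppr0 // exprS mulN1r.
Qed.

Lemma mobius_nonsquarefree (p d : nat) :
  prime p -> (0 < d)%N -> (p ^ 2 %| d)%N -> mobius d = 0.
Proof.
move=> p_pr d_gt0; rewrite pfactor_dvdn // => p2; rewrite /mobius.
case: allP => // /(_ p); rewrite -logn_gt0 => /(_ (ltnW p2)) /eqP p1.
by rewrite p1 in p2.
Qed.

(** For a prime p dividing m, the divisors of m that p^2 divides contribute
    nothing, and the others come in pairs e, p * e with p not dividing e, whose
    terms cancel. *)
Lemma sum_mobius (m : nat) :
  (0 < m)%N -> \sum_(d <- divisors m) mobius d = (m == 1%N)%:R.
Proof.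
move=> m_gt0; have [->|m_neq1] := eqVneq m 1%N; first by rewrite big_seq1.
have m_gt1 : (1 < m)%N by lia.
have [p_pr p_m] := (pdiv_prime m_gt1, pdiv_dvd m); set p := pdiv m in p_pr p_m.
have p_gt0 := prime_gt0 p_pr.
rewrite (bigID (fun d => ~~ (p %| d)%N)) /=.
under [X in _ + X]eq_bigl do rewrite negbK.
rewrite [X in _ + X](bigID (fun d => (p ^ 2 %| d)%N)) /=.
have -> : \sum_(d <- divisors m | (p %| d)%N && (p ^ 2 %| d)%N) mobius d = 0.
  rewrite big_seq_cond big1 // => d /and3P[].
  rewrite -dvdn_divisors // => d_m _.
  exact/mobius_nonsquarefree/(dvdn_gt0 m_gt0).
rewrite add0r.
have pairing : perm_eq
    [seq d <- divisors m | (p %| d)%N && ~~ (p ^ 2 %| d)%N]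
    [seq (p * e)%N | e <- [seq e <- divisors m | ~~ (p %| e)%N]].
  apply: uniq_perm.
  - exact/filter_uniq/divisors_uniq.
  - rewrite map_inj_uniq ?filter_uniq ?divisors_uniq // => x y /eqP.
    by rewrite eqn_pmul2l // => /eqP.
  - move=> d; rewrite mem_filter -dvdn_divisors //; apply/idP/mapP.
      case/andP=> /andP[/dvdnP[e ->]]; rewrite (mulnC e) expnS expn1.
      rewrite dvdn_pmul2l // => pNe pe_m; exists e => //.
      by rewrite mem_filter pNe -dvdn_divisors // (dvdn_trans _ pe_m) ?dvdn_mull.
    case=> e; rewrite mem_filter -dvdn_divisors // => /andP[pNe e_m] ->.
    rewrite dvdn_mulr // expnS expn1 dvdn_pmul2l // pNe /=.
    by rewrite Gauss_dvd ?p_m // prime_coprime.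
rewrite -[X in _ + X]big_filter (perm_big _ pairing) big_map big_filter /=.
rewrite -big_split big_seq_cond big1 //= => e /andP[].
rewrite -dvdn_divisors // => e_m pNe.
by rewrite mobius_mul_prime ?subrr // (dvdn_gt0 m_gt0).
Qed.

(** The d dividing m with even codivisor m / d are the divisors of m / 2 when m
    is even, and there are none when m is odd. *)
Lemma sum_mobius_even_codivisor (m : nat) : (0 < m)%N ->
  \sum_(d <- divisors m | ~~ odd (m %/ d)) mobius d = (m == 2%N)%:R.
Proof.
move=> m_gt0; have [m_odd|m_even] := boolP (odd m).
  rewrite big_seq_cond big1; first by case: eqP m_odd => // ->.
  move=> d /andP[]; rewrite -dvdn_divisors // => /dvdnP[k mE].
  move: m_odd m_gt0; rewrite mE oddM muln_gt0 => /andP[k_odd _] /andP[_ d_gt0].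
  by rewrite mulnK // k_odd.
have [h mE] : exists h, m = (h * 2)%N.
  by exists m./2; rewrite muln2 even_halfK.
have h_gt0 : (0 < h)%N by lia.
rewrite -big_filter (perm_big (divisors h)) /=.
  by rewrite sum_mobius // mE -[2%N in RHS]mul1n eqn_pmul2r.
apply: uniq_perm; rewrite ?filter_uniq ?divisors_uniq // => d.
rewrite mem_filter -!dvdn_divisors //; apply/andP/idP.
  case=> + /dvdnP[k mk]; have d_gt0 : (0 < d)%N by move: m_gt0; rewrite mk; lia.
  rewrite mk mulnK // => k_even; apply/dvdnP; exists k./2.
  by apply: double_inj; rewrite -muln2 -mE mk doubleMl even_halfK.
move=> /dvdnP[k hk]; have d_gt0 : (0 < d)%N by move: h_gt0; rewrite hk; lia.
have -> : m = ((k * 2) * d)%N by lia.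
by rewrite mulnK // dvdn_mull // oddM andbF.
Qed.

(** * The splitting factors at -1 *)

(** Each (-1)^(m / d) is twice the indicator of m / d being even, minus 1, so
    the sum is a combination of the two divisor sums above; it is computed over
    the integers, where mu takes its values, and then mapped to F. *)
Lemma necklace_at_N1 (F : numFieldType) (m : nat) : (0 < m)%N ->
  (necklace F m).[-1] = (m == 2%N)%:R - (m == 1%N)%:R.
Proof.
move=> m_gt0.
have eval_int : \sum_(d <- divisors m) mobius d * (-1) ^+ (m %/ d) =
    (m == 2%N)%:R *+ 2 - (m == 1%N)%:R :> int.
  rewrite -sum_mobius_even_codivisor // -sum_mobius // [in RHS]big_mkcond /=.
  rewrite -sumrMnl -sumrB; apply: eq_bigr => d _.
  by rewrite -signr_odd; case: odd; rewrite /= ?expr0 ?expr1; ring.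
have -> : (necklace F m).[-1] = m%:R^-1 * ((m == 2%N)%:R *+ 2 - (m == 1%N)%:R).
  rewrite /necklace hornerZ horner_sum; congr (_ * _).
  transitivity ((((m == 2%N)%:R *+ 2 - (m == 1%N)%:R) : int)%:~R : F).
    rewrite -eval_int rmorph_sum; apply: eq_bigr => d _.
    by rewrite hornerZ hornerXn rmorphM /= rmorphXn /= rmorphN1.
  by rewrite rmorphB rmorphMn /= !rmorph_nat.
have [->|m2] := eqVneq m 2%N; first by rewrite /= !subr0 mulVf // pnatr_eq0.
have [->|m1] := eqVneq m 1%N; first by rewrite /= invr1 mul1r mul0rn.
by rewrite mul0rn subrr mulr0.
Qed.

Lemma gbinomN1 (F : numFieldType) (k : nat) : gbinom (-1 : F) k = (-1) ^+ k.
Proof.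
rewrite /gbinom; have -> : \prod_(i < k) (-1 - i%:R) = (-1) ^+ k * k`!%:R :> F.
  elim: k => [|k IHk]; first by rewrite big_ord0 fact0 mulr1.
  by rewrite big_ord_recr /= IHk factS natrM exprS -natr1; ring.
by rewrite mulfK // pnatr_eq0 -lt0n fact_gt0.
Qed.

(** The factor of index a in the numerator is a - a. *)
Lemma gbinom_nat_small (F : numFieldType) (a k : nat) : (a < k)%N ->
  gbinom (a%:R : F) k = 0.
Proof.
by move=> ltak; rewrite /gbinom (bigD1 (Ordinal ltak)) //= subrr !mul0r.
Qed.

Lemma gbinom0 (F : numFieldType) (k : nat) : gbinom (0 : F) k = (k == 0%N)%:R.
Proof.
case: k => [|k]; last by rewrite (@gbinom_nat_small F 0).
by rewrite /gbinom big_ord0 divr1.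
Qed.

Lemma gbinom1 (F : numFieldType) (k : nat) : gbinom (1 : F) k = (k < 2)%:R.
Proof.
case: k => [|[|k]]; last by rewrite (@gbinom_nat_small F 1).
  by rewrite /gbinom big_ord0 divr1.
by rewrite /gbinom big_ord1 subr0 divr1.
Qed.

(** The factors j = 1, j = 2 and j >= 3 are binomials of -1, 1 and 0. *)
Lemma splitting_class_at_N1 (F : numFieldType) (n : nat) (la : seq nat) :
  (2 <= n)%N -> splitting_class n (-1 : F) la =
  ((-1) ^+ n * 2)^-1 * ((-1) ^+ count_mem 1%N la * (count_mem 2%N la < 2)%:R *
    \prod_(3 <= j < n.+1) (count_mem j la == 0%N)%:R).
Proof.
move=> n_ge2; rewrite /splitting_class; congr (_^-1 * _).
  by case: n n_ge2 => // n _; rewrite exprS /=; ring.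
rewrite big_ltn ?ltnS ?(ltnW n_ge2) // big_ltn ?ltnS //.
rewrite !necklace_at_N1 //= sub0r subr0 gbinomN1 gbinom1 mulrA; congr (_ * _).
rewrite big_nat [RHS]big_nat; apply: eq_bigr => j /andP[j_ge3 _].
rewrite necklace_at_N1 ?(leq_trans _ j_ge3) //.
rewrite (gtn_eqF j_ge3) (gtn_eqF (ltnW j_ge3)).
by rewrite subrr gbinom0.
Qed.

(** * Partitions with almost as many parts as their size *)

Lemma size_le_sumn (la : seq nat) : all (leq 1) la -> (size la <= sumn la)%N.
Proof. by elim: la => //= a la IHla /andP[a_gt0 /IHla]; lia. Qed.

Lemma sumn_eq_size (la : seq nat) :
  all (leq 1) la -> sumn la = size la -> la = nseq (size la) 1%N.
Proof.
elim: la => //= a la IHla /andP[a_gt0 la_gt0] sum_la.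
have size_le := size_le_sumn la_gt0.
by rewrite -IHla //; first (congr (_ :: _); lia); lia.
Qed.

Lemma partition_size_max (n : nat) (la : seq nat) :
  is_partition n la -> size la = n -> la = nseq n 1%N.
Proof.
case/and3P=> _ la_gt0 /eqP sum_la size_la; rewrite -size_la.
by apply: sumn_eq_size; lia.
Qed.

(** The excess over 1 of the parts totals 1, hence is carried by a single part;
    sortedness puts it in front. *)
Lemma partition_size_submax (n : nat) (la : seq nat) :
  is_partition n la -> (size la).+1 = n -> la = 2%N :: nseq (n - 2) 1%N.
Proof.
case/and3P; case: la => [|a la] /=; first by move=> _ _ /eqP <-.
move=> la_sorted /andP[a_gt0 la_gt0] /eqP sum_la size_la.
have la_le_a : all (geq a) la.
  by apply: order_path_min la_sorted => x y z /=; lia.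
have size_le := size_le_sumn la_gt0.
(* If the largest part were 1, all parts would be 1 and the sum too small. *)
have a2 : a = 2%N.
  suff : a != 1%N by lia.
  apply/eqP=> a1; suff /(congr1 sumn) : la = nseq (size la) 1%N.
    by rewrite sumn_nseq; lia.
  apply/all_pred1P; apply/allP=> b b_la /=.
  by move: (allP la_le_a b b_la) (allP la_gt0 b b_la) => /=; lia.
rewrite a2 (@sumn_eq_size la) //; last by lia.
by congr (_ :: nseq _ _); lia.
Qed.

(** When all parts are 1 or 2, the multiplicity of 2 is the defect between the
    size of the partition and its number of parts. *)
Lemma partition_parts_le2 (n : nat) (la : seq nat) : is_partition n la ->
  (forall j, (3 <= j < n.+1)%N -> count_mem j la = 0%N) ->
  n = (size la + count_mem 2%N la)%N.
Proof.
case/and3P=> _ la_gt0 /eqP <- no_big.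
have la_le2 : all (fun j => (0 < j < 3)%N) la.
  apply/allP=> j j_la; rewrite (allP la_gt0) //= ltnNge; apply/negP=> j_ge3.
  have j_le : (j < (sumn la).+1)%N.
    rewrite ltnS; elim: la j_la {la_gt0 no_big} => //= a la IHla.
    by rewrite inE => /predU1P[->|/IHla]; lia.
  have := no_big j; rewrite j_ge3 j_le => /(_ isT) /eqP.
  by apply/negP; rewrite -lt0n -has_count has_pred1.
elim: la la_le2 {la_gt0 no_big} => //= a la IHla /andP[a12 /IHla ->].
by case: (a =P 2%N) => /=; lia.
Qed.

(** * Permutations of cycle type [1^n] and [2,1^(n-2)] *)

Lemma cycle_type_partition (n : nat) (s : 'S_n) : is_partition n (cycle_type s).
Proof.
have geq_total : total geq by move=> x y; rewrite /= orbC leq_total.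
apply/and3P; split; first exact: sort_sorted.
  rewrite /cycle_type all_sort; apply/allP=> k /mapP[B].
  by rewrite mem_enum => /imsetP[x _ ->] ->; rewrite lt0n card_porbit_neq0.
rewrite /cycle_type (perm_sumn (permEl (perm_sort _ _))) sumnE big_map big_enum.
rewrite -(@card_partition _ _ [set: 'I_n]) ?cardsT ?card_ord //.
have -> : porbits s = [set orbit 'P <[s]> x | x in [set: 'I_n]].
  by apply/setP=> B; apply/imsetP/imsetP=> -[x _ ->]; exists x; rewrite ?porbitE.
by apply/orbit_partition/actsP => a _ x; rewrite !inE.
Qed.

Lemma size_cycle_type (n : nat) (s : 'S_n) :
  size (cycle_type s) = #|porbits s|.
Proof. by rewrite /cycle_type size_sort size_map -cardE. Qed.

Lemma porbits_perm1 (n : nat) : #|porbits (1 : 'S_n)%g| = n.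
Proof.
rewrite /porbits card_imset ?card_ord // => x y /eqP.
by rewrite eq_porbit_mem => /porbitP[i ->]; rewrite expg1n perm1.
Qed.

(** With as many cycles as points, the map sending a point to its cycle is
    injective, while x and s x always share a cycle. *)
Lemma card_porbits_max (n : nat) (s : 'S_n) : #|porbits s| = n -> s = 1%g.
Proof.
move=> card_s; have porbit_inj : {in 'I_n &, injective (porbit s)}.
  by apply/imset_injP; rewrite card_ord -[X in _ == X]card_s.
apply/permP=> x; rewrite perm1; apply: porbit_inj => //; apply/eqP.
by rewrite eq_porbit_mem -{1}[s]expg1 mem_porbit.
Qed.

Lemma card_porbits_tperm (n : nat) (x y : 'I_n) :
  x != y -> (#|porbits (tperm x y)|).+1 = n.
Proof.
move=> xy; have := porbits_mul_tperm 1%g x y.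
have -> : x \notin porbit 1%g y.
  by apply: contraNN xy => /porbitP[i ->]; rewrite expg1n perm1.
by rewrite /= mulg1 porbits_perm1 xy; lia.
Qed.

(** For a point x moved by s, multiplying s by the transposition of x and s x
    splits their common cycle; the product then has n cycles, so is 1. *)
Lemma card_porbits_submax (n : nat) (s : 'S_n) :
  (#|porbits s|).+1 = n ->
  exists2 xy : 'I_n * 'I_n, xy.1 != xy.2 & s = tperm xy.1 xy.2.
Proof.
move=> card_s; have [x sx] : exists x, s x != x.
  apply/existsP; apply: contra_eqT card_s; rewrite negb_exists => /forallP s_id.
  have -> : s = 1%g by apply/permP=> x; rewrite perm1; apply/eqP/negPn.
  by rewrite porbits_perm1; lia.
exists (x, s x) => /=; first by rewrite eq_sym.
apply/eqP; rewrite -(inj_eq (mulgI (tperm x (s x)))) tperm2; apply/eqP.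
apply: card_porbits_max; have := porbits_mul_tperm s x (s x).
have sx_orbit : s x \in porbit s x by rewrite -{1}[s]expg1 mem_porbit.
rewrite /= porbit_sym sx_orbit eq_sym sx.
by rewrite addn0 addn1 card_s.
Qed.

Lemma cycle_class_id (n : nat) : cycle_class n (nseq n 1%N) = [set 1%g].
Proof.
apply/setP=> s; rewrite !inE; apply/eqP/eqP=> [s_type|->].
  by apply: card_porbits_max; rewrite -size_cycle_type s_type size_nseq.
apply: partition_size_max; first exact: cycle_type_partition.
by rewrite size_cycle_type porbits_perm1.
Qed.

Lemma cycle_type_tperm (n : nat) (x y : 'I_n) :
  x != y -> cycle_type (tperm x y) = 2%N :: nseq (n - 2) 1%N.
Proof.
move=> xy; apply: partition_size_submax; first exact: cycle_type_partition.
by rewrite size_cycle_type card_porbits_tperm.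
Qed.

(** Conjugating by s sends the transposition of x and y to that of s x and s y,
    so it suffices that some s maps x to a and y to b. *)
Lemma tperm_conjugate (T : finType) (x y a b : T) : x != y -> a != b ->
  exists s : {perm T}, tperm a b = (tperm x y ^ s)%g.
Proof.
(* The first factor sends x to a; the second moves the image of y to b and
   fixes a. *)
move=> xy ab; exists (tperm x a * tperm (tperm x a y) b)%g.
rewrite tpermJ !permM !tpermL tpermD // 1?eq_sym // -[X in X != _](tpermL x a).
by rewrite (inj_eq perm_inj).
Qed.

Lemma cycle_class_tperm (n : nat) (x y : 'I_n) : x != y ->
  cycle_class n (2%N :: nseq (n - 2) 1%N) = (tperm x y ^: [set: 'S_n])%g.
Proof.
move=> xy; have n_ge2 : (2 <= n)%N.
  case: n x y xy => [|[|n]] // x y; first by case: x.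
  by rewrite !ord1 eqxx.
apply/setP=> s; rewrite inE; apply/eqP/imsetP=> [s_type|[t _ ->]].
  have [|[a b] /= ab ->] := @card_porbits_submax n s.
    by rewrite -size_cycle_type s_type /= size_nseq; lia.
  by have [t ->] := tperm_conjugate xy ab; exists t; rewrite ?inE.
by rewrite tpermJ cycle_type_tperm // (inj_eq perm_inj).
Qed.

(** * The measure at -1 *)

Lemma splitting_class_id (F : numFieldType) (n : nat) : (2 <= n)%N ->
  splitting_class n (-1 : F) (nseq n 1%N) = 2^-1.
Proof.
move=> n_ge2; rewrite splitting_class_at_N1 // !count_nseq /= mul1n mulr1.
rewrite big_nat big1 => [|j /andP[j_ge3 _]]; last first.
  by rewrite count_nseq /= (ltn_eqF (ltnW j_ge3)).
by rewrite mulr1 invfM mulrAC mulVf ?mul1r // signr_eq0.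
Qed.

Lemma splitting_class_cyc2 (F : numFieldType) (n : nat) : (2 <= n)%N ->
  splitting_class n (-1 : F) (2%N :: nseq (n - 2) 1%N) = 2^-1.
Proof.
move=> n_ge2; rewrite splitting_class_at_N1 //= !count_nseq /= mul1n mulr1.
rewrite big_nat big1 => [|j /andP[j_ge3 _]]; last first.
  by rewrite count_nseq /= (ltn_eqF j_ge3) (ltn_eqF (ltnW j_ge3)).
rewrite mulr1 add0n -{1}(subnK n_ge2) exprD sqrrN expr1n mulr1.
by rewrite invfM mulrAC mulVf ?mul1r // signr_eq0.
Qed.

(** Nonvanishing forces m_2(la) <= 1 and no part above 2, so la has n or n - 1
    parts. *)
Lemma splitting_class_support (F : numFieldType) (n : nat) (la : seq nat) :
  (2 <= n)%N -> is_partition n la ->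
  (splitting_class n (-1 : F) la != 0) =
  (la \in [:: nseq n 1%N; 2%N :: nseq (n - 2) 1%N]).
Proof.
move=> n_ge2 la_part; apply/idP/idP => [|la_in]; last first.
  suff -> : splitting_class n (-1 : F) la = 2^-1 by rewrite invr_eq0 pnatr_eq0.
  move: la_in; rewrite !inE => /orP[] /eqP ->.
    exact: splitting_class_id.
  exact: splitting_class_cyc2.
rewrite splitting_class_at_N1 // !mulf_eq0 !negb_or.
move=> /andP[_ /andP[/andP[_ m2]]]; rewrite prodf_seq_neq0 => /allP no_big.
have n_eq : n = (size la + count_mem 2%N la)%N.
  apply: partition_parts_le2 => // j j_range; apply/eqP.
  have := no_big j; rewrite mem_index_iota j_range => /(_ isT) /=.
  by case: (count_mem j la == 0%N); rewrite ?eqxx.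
rewrite !inE; move: m2 n_eq.
case: (count_mem 2%N la) => [|[|m]] /=; rewrite ?eqxx //.
  by move=> _ n_eq; rewrite (partition_size_max la_part) ?eqxx //; lia.
by move=> _ n_eq; rewrite (partition_size_submax la_part) ?eqxx ?orbT //; lia.
Qed.

Lemma splitting_measure_class (F : numFieldType) (n : nat) (z : F)
    (la : seq nat) : cycle_class n la != set0 ->
  splitting_measure z (cycle_class n la) = splitting_class n z la.
Proof.
move=> la_n0; rewrite /splitting_measure.
rewrite (eq_bigr (fun=> splitting_class n z la / #|cycle_class n la|%:R)).
  by rewrite sumr_const -[LHS]mulr_natr divfK // pnatr_eq0 cards_eq0.
by move=> g; rewrite inE /splitting_elt => /eqP ->.
Qed.

(* The order on R[i] is the partial one: 0 <= w means that w is real and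
   nonnegative. *)
Theorem theorem6p1 (R : realType) (n : nat) (hn : (2 <= n)%N) :
  let id_type := nseq n 1%N in
  let cyc2_type := 2%N :: nseq (n - 2) 1%N in
  [/\ forall g : 'S_n, 0 <= splitting_elt (-1 : R[i]) g,
      cycle_class n id_type = [set 1%g],
      forall x y : 'I_n, x != y ->
        cycle_class n cyc2_type = (tperm x y ^: [set: 'S_n])%g,
      (forall la : seq nat, is_partition n la ->
        (splitting_class n (-1 : R[i]) la != 0) =
        (la \in [:: id_type; cyc2_type])) /\
      [set g : 'S_n | splitting_elt (-1 : R[i]) g != 0] =
        cycle_class n id_type :|: cycle_class n cyc2_type
    & forall la : seq nat, la \in [:: id_type; cyc2_type] ->
        splitting_class n (-1 : R[i]) la = 2^-1 /\
        splitting_measure (-1 : R[i]) (cycle_class n la) = 2^-1].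
Proof.
move=> id_type cyc2_type.
have support la : is_partition n la ->
    (splitting_class n (-1 : R[i]) la != 0) = (la \in [:: id_type; cyc2_type]).
  exact: splitting_class_support.
have mass la : la \in [:: id_type; cyc2_type] ->
    splitting_class n (-1 : R[i]) la = 2^-1.
  rewrite !inE => /orP[] /eqP ->; first exact: splitting_class_id.
  exact: splitting_class_cyc2.
split.
- move=> g; rewrite /splitting_elt; apply: divr_ge0; last exact: ler0n.
  have := support _ (cycle_type_partition g).
  case: eqP => [->|_ /esym/mass ->] //.
  by rewrite invr_ge0 ler0n.
- exact: cycle_class_id.
- exact: cycle_class_tperm.
- split=> //; apply/setP=> g; rewrite in_set /splitting_elt mulf_eq0 negb_or.
  rewrite support ?cycle_type_partition // invr_eq0 pnatr_eq0 cards_eq0.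
  have -> : cycle_class n (cycle_type g) != set0.
    by apply/set0Pn; exists g; rewrite inE.
  by rewrite andbT !inE.
- move=> la la_in; split; first exact: mass.
  rewrite splitting_measure_class ?mass //; apply/set0Pn.
  move: la_in; rewrite !inE => /orP[] /eqP ->.
    by exists 1%g; rewrite cycle_class_id inE.
  exists (tperm (Ordinal (ltnW hn)) (Ordinal hn)).
  by rewrite inE cycle_type_tperm.
Qed.
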